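(* Let $\mathfrak{A}$ be a residuated lattice with underlying set $A$. Then $(Min(\mathfrak{A});\tau_h)$ is an extremally disconnected space if and only if $h(X^{\perp})$ is open in $(Min(\mathfrak{A});\tau_h)$ for every $X\subseteq A$.
   Context: A residuated lattice is an algebra $\mathfrak{A}=(A;\vee,\wedge,\odot,\rightarrow,0,1)$ such that $(A;\vee,\wedge,0,1)$ is a bounded lattice, $(A;\odot,1)$ is a commutative monoid, and $(\odot,\rightarrow)$ is an adjoint pair, i.e. $x\odot y\le z$ iff $x\le y\rightarrow z$. A filter of $\mathfrak{A}$ is a non-empty subset $F\subseteq A$ such that $x,y\in F$ implies $x\odot y\in F$, and $x\in F$, $y\in A$ imply $x\vee y\in F$. A filter is proper if it is not equal to $A$. A proper filter $P$ is prime if for all filters $F_1,F_2$, $F_1\cap F_2=P$ implies $F_1=P$ or $F_2=P$. $Min(\mathfrak{A})$ is the set of minimal prime filters (minimal elements, under inclusion, among all prime filters). For $X\subseteq A$ let $X^{\perp}=\{a\in A\mid x\vee a=1 \text{ for all } x\in X\}$ and $h(X)=\{P\in Min(\mathfrak{A})\mid X\subseteq P\}$. The hull-kernel topology $\tau_h$ on $Min(\mathfrak{A})$ is the topology whose closed sets are the sets $h(X)$, $X\subseteq A$. A topological space is extremally disconnected if the closure of every open set is open. *)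

(* Defs.v *)
From HB Require Import structures.
From mathcomp Require Import all_boot all_order.
From mathcomp Require Import boolp classical_sets topology.

Set Implicit Arguments.
Unset Strict Implicit.
Unset Printing Implicit Defensive.

Import Order.TTheory.

Local Open Scope classical_set_scope.

(* [tbLatticeType] provides the bounded lattice (with 0 and 1 written [\bot]
   and [\top]); its choice structure is no restriction classically, see
   [boolp.classicType]. *)
HB.mixin Record isResiduatedLattice (d : Order.disp_t) A
    of Order.TBLattice d A := {
  rmul : A -> A -> A;
  rimp : A -> A -> A;
  rmulA : associative rmul;
  rmulC : commutative rmul;
  rmul1 : left_id (\top%O : A) rmul;
  rmul_adj : forall x y z : A, (rmul x y <= z)%O = (x <= rimp y z)%O
}.

#[short(type="residuatedLatticeType")]
HB.structure Definition ResiduatedLattice (d : Order.disp_t) :=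
  { A of Order.TBLattice d A & isResiduatedLattice d A }.

Section Filters.
Context {d : Order.disp_t} {A : residuatedLatticeType d}.
Implicit Types (F P Q X Y : set A) (a x y z : A).

Definition rfilter F : Prop :=
  [/\ F !=set0,
      forall x y, F x -> F y -> F (rmul x y) &
      forall x y, F x -> F (x `|` y)%O].

Definition proper_rfilter F : Prop := rfilter F /\ F <> setT.

Definition prime_rfilter P : Prop :=
  proper_rfilter P /\
  (forall F1 F2, rfilter F1 -> rfilter F2 ->
     F1 `&` F2 = P -> F1 = P \/ F2 = P).

Definition minimal_prime_rfilter P : Prop :=
  prime_rfilter P /\ (forall Q, prime_rfilter Q -> Q `<=` P -> Q = P).

Definition perp X : set A := [set a | forall x, X x -> (x `|` a)%O = \top%O].

End Filters.

(* A record rather than the subtype [set_type], which would inherit the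
   subspace topology of the product topology on [set A = A -> Prop]. *)
Record minSpec (d : Order.disp_t) (A : residuatedLatticeType d) := MinSpec {
  minSpec_set :> set A;
  minSpecP : minimal_prime_rfilter minSpec_set
}.

HB.instance Definition _ (d : Order.disp_t) (A : residuatedLatticeType d) :=
  gen_eqMixin (minSpec A).
HB.instance Definition _ (d : Order.disp_t) (A : residuatedLatticeType d) :=
  gen_choiceMixin (minSpec A).

Definition hull (d : Order.disp_t) (A : residuatedLatticeType d) (X : set A) :
  set (minSpec A) := [set P : minSpec A | X `<=` P].

Section HullKernel.
Context {d : Order.disp_t} {A : residuatedLatticeType d}.
Implicit Types (F P X Y : set A) (x y z : A).

Lemma rmul_le2 x y z (t : A) :
  (x <= y)%O -> (z <= t)%O -> (rmul x z <= rmul y t)%O.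
Proof.
have le2l a b c : (a <= b)%O -> (rmul a c <= rmul b c :> A)%O.
  by move=> ab; rewrite rmul_adj; apply: le_trans ab _; rewrite -rmul_adj.
move=> xy zt; apply: le_trans (le2l _ _ z xy) _.
by rewrite ![rmul y _]rmulC; exact: le2l.
Qed.

Lemma rmul_lel x y : (rmul x y <= x)%O.
Proof. by rewrite -[leRHS]rmul1 rmulC; apply: rmul_le2; rewrite ?lex1. Qed.

Lemma rmul_join_le x y z :
  (rmul (x `|` z) (y `|` z) <= rmul x y `|` z)%O.
Proof.
rewrite rmul_adj leUx; apply/andP; split; rewrite -rmul_adj; last first.
  by apply: le_trans (rmul_lel _ _) _; rewrite leUr.
rewrite rmulC rmul_adj leUx; apply/andP; split; rewrite -rmul_adj.
  by rewrite rmulC leUl.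
by apply: le_trans (rmul_lel _ _) _; rewrite leUr.
Qed.

Lemma rfilter_le F x y : rfilter F -> (x <= y)%O -> F x -> F y.
Proof. by case=> _ _ FU /join_idPl <- Fx; rewrite joinC; exact: FU. Qed.

Lemma rfilter1 F : rfilter F -> F \top%O.
Proof. by move=> FF; case: (FF) => -[x Fx] _ _; apply: rfilter_le Fx; rewrite ?lex1. Qed.

Lemma prime_rfilterU P x y :
  prime_rfilter P -> P (x `|` y)%O -> P x \/ P y.
Proof.
move=> [[FP _] Pprime] Pxy; have [_ PM PU] := FP.
pose F1 : set A := [set z | P (z `|` y)%O].
pose F2 : set A := [set w | forall z, F1 z -> P (w `|` z)%O].
have FF1 : rfilter F1.
  split=> [|z w Pz Pw|z w Pz] /=.
  - by exists \top%O; rewrite /F1 /= join1x; exact: rfilter1.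
  - exact: rfilter_le (rmul_join_le _ _ _) (PM _ _ Pz Pw).
  - by rewrite /F1 /= joinAC; exact: PU.
have FF2 : rfilter F2.
  split=> [|z w Pz Pw t F1t|z w Pz t F1t] /=.
  - by exists \top%O => z _; rewrite join1x; exact: rfilter1.
  - apply: rfilter_le FP (rmul_join_le _ _ _) (PM _ _ (Pz _ F1t) (Pw _ F1t)).
  - by rewrite joinAC; apply: PU; exact: Pz.
have F12 : F1 `&` F2 = P.
  apply/seteqP; split=> [z [F1z F2z]|z Pz]; first by rewrite -[z]joinxx; exact: F2z.
  by split=> [|w _]; exact: PU.
have [F1P|F2P] := Pprime _ _ FF1 FF2 F12; [left; rewrite -F1P //|right].
by rewrite -F2P => z; rewrite /F1 /= joinC.
Qed.

Lemma hull0 : @hull d A set0 = setT.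
Proof. by apply/seteqP; split=> // P _ x []. Qed.

Lemma hullT : @hull d A setT = set0.
Proof.
apply/seteqP; split=> // P /= TP; have [[[_ PnT] _] _] := minSpecP P.
by apply: PnT; apply/seteqP.
Qed.

Lemma hullU X Y :
  hull X `|` hull Y = hull [set (x `|` y)%O | x in X & y in Y].
Proof.
apply/seteqP; split=> [P XYP z [x Xx [y Yy <-]]|P XYP] /=.
  have [[[[_ _ PU] _] _] _] := minSpecP P.
  by case: XYP => [XP|YP]; [|rewrite joinC]; apply: PU; [exact: XP|exact: YP].
have [XP|/existsNP[x /not_implyP[Xx nPx]]] := pselect (X `<=` P); first by left.
right=> y Yy; have [//|//] : minSpec_set P x \/ minSpec_set P y.
apply: prime_rfilterU; first by case: (minSpecP P).
by apply: XYP; exists x => //; exists y.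
Qed.

Lemma hull_bigcup (I : Type) (f : I -> set A) :
  hull (\bigcup_i f i) = \bigcap_i hull (f i).
Proof.
apply/seteqP; split=> [P fP i _ x fix_|P fP x [i _ fix_]].
  by apply: fP; exists i.
exact: (fP i).
Qed.

Definition hull_open (U : set (minSpec A)) : Prop :=
  exists X : set A, ~` U = hull X.

Lemma hull_openT : hull_open setT.
Proof. by exists setT; rewrite hullT setCT. Qed.

Lemma hull_openI : setI_closed hull_open.
Proof. by move=> U V [X UX] [Y VY]; rewrite /hull_open setCI UX VY hullU; eexists. Qed.

Lemma hull_open_bigcup (I : Type) (f : I -> set (minSpec A)) :
  (forall i, hull_open (f i)) -> hull_open (\bigcup_i f i).
Proof.
move=> /choice[X fX]; exists (\bigcup_i X i).
by rewrite setC_bigcup hull_bigcup; apply: eq_bigcapr => i _.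
Qed.

HB.instance Definition _ := isOpenTopological.Build (minSpec A)
  hull_openT hull_openI hull_open_bigcup.

Lemma closed_hullP (C : set (minSpec A)) :
  closed C <-> exists X : set A, C = hull X.
Proof.
by rewrite -openC /open /= /hull_open setCK.
Qed.

End HullKernel.

Definition extremally_disconnected (T : topologicalType) : Prop :=
  forall U : set T, open U -> open (closure U).

(* Main.v *)
(** The minimal prime filters of a residuated lattice intersect in [{1}].
    Hence, for the open set [~` hull X], a closed set [hull Y] contains it
    exactly when [x `|` y] lies in every minimal prime for all [x] in [X] and
    [y] in [Y], that is, when [Y `<=` perp X]. So the closure of [~` hull X] is
    [hull (perp X)], and both sides of the equivalence say that these
    closures are open. *)

Require Import Defs.
From mathcomp Require Import all_boot all_order.
From mathcomp Require Import boolp classical_sets topology.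

Import Order.TTheory.
Local Open Scope classical_set_scope.

Section MinimalPrimes.
Context {d : Order.disp_t} {A : residuatedLatticeType d}.
Implicit Types (F P Q X Y : set A) (a x y z : A).

(** If [x] in [F1] lies outside [P], then for every [y] in [F2] the join of [x] and [y] is in both
    filters, hence in [P], which forces [y] into [P]. Unlike the definition of primality, this
    criterion passes easily to intersections of chains. *)
Lemma prime_rfilter_join P : rfilter P -> P <> setT ->
  (forall x y, P (x `|` y)%O -> P x \/ P y) -> prime_rfilter P.
Proof.
move=> FP PnT PU; split=> // F1 F2 [_ _ F1U] [_ _ F2U] F12.
have [F1P|/existsNP[x /not_implyP[F1x nPx]]] := pselect (F1 `<=` P).
  by left; apply/seteqP; split=> // z; rewrite -F12 => -[].
right; apply/seteqP; split=> [y F2y|z]; last by rewrite -F12 => -[].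
have : P (x `|` y)%O.
  by rewrite -F12; split; [exact: F1U|rewrite joinC; exact: F2U].
by move=> /PU[].
Qed.

(** A filter maximal among those avoiding [a] is prime: two filters strictly above it both contain
    [a], so their intersection cannot be that filter. *)
Lemma exists_prime_rfilter_notin a : a <> \top%O ->
  exists2 P : set A, prime_rfilter P & ~ P a.
Proof.
move=> a1.
(* Adjoining the top element makes the empty chain harmless in Zorn's lemma. *)
pose good (S : set A) := rfilter (\top%O |` S) /\ ~ S a.
have [|M [[FM nMa] Mmax]] := @Zorn_bigcup A good.
  move=> C Cgood Ctot; split; last by move=> [S CS Sa]; case: (Cgood _ CS).
  have sub S : C S -> (\top%O : A) |` S `<=` \top%O |` \bigcup_(X in C) X.
    by move=> CS x [->|Sx]; [left|right; exists S].
  split=> [|x y|x y].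
  - by exists \top%O; left.
  - case=> [->|[S CS Sx]]; first by rewrite rmul1.
    case=> [->|[T CT Ty]]; first by rewrite rmulC rmul1; right; exists S.
    have [ST|TS] := Ctot _ _ CS CT.
    + apply: (sub _ CT); have [[_ TM _] _] := Cgood _ CT.
      by apply: TM; right => //; exact: ST.
    + apply: (sub _ CS); have [[_ SM _] _] := Cgood _ CS.
      by apply: SM; right => //; exact: TS.
  - case=> [->|[S CS Sx]]; first by rewrite join1x; left.
    apply: (sub _ CS); have [[_ _ SU] _] := Cgood _ CS.
    by apply: SU; right.
pose P := (\top%O : A) |` M.
have nPa : ~ P a by case.
have max F : rfilter F -> P `<=` F -> F <> P -> F a.
  move=> FF PF FnP; apply: contrapT => nFa.
  have F1 : \top%O |` F = F.
    by apply: setUidr => _ ->; exact: rfilter1.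
  apply: (Mmax F); last by split=> //; rewrite F1.
  split=> [|FM']; last first.
    by apply: FnP; apply/seteqP; split=> // x /FM'; right.
  by move=> x Mx; apply: PF; right.
exists P => //; split; first by split=> // PT; apply: nPa; rewrite PT.
move=> F1 F2 FF1 FF2 F12; apply: contrapT => /not_orP[F1P F2P].
apply: nPa; rewrite -F12; split; apply: max => //; rewrite -F12.
- exact: subIsetl.
- exact: subIsetr.
Qed.

(** The intersection of a nonempty chain of primes is prime: if one member omits [x] and another
    omits [y], the smaller of the two omits both. *)
Lemma exists_minimal_prime_rfilter P : prime_rfilter P ->
  exists2 Q : set A, minimal_prime_rfilter Q & Q `<=` P.
Proof.
move=> primeP; have [[FP PnT] _] := primeP; have [_ PM PU] := FP.
(* Zorn's lemma is applied to the sets removed from [P]. *)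
have [|M [primeM Mmax]] := @Zorn_bigcup A (fun S => prime_rfilter (P `\` S)).
  move=> C Cprime Ctot; apply: prime_rfilter_join.
  - split=> [|x y [Px nx] [Py ny]|x y [Px nx]].
    + exists \top%O; split; first exact: rfilter1.
      by move=> [S /Cprime[[/rfilter1[]]]].
    + split; first exact: PM.
      move=> [S CS Sxy]; have [[[_ SM _] _] _] := Cprime _ CS.
      suff [] : (P `\` S) (rmul x y) by [].
      by apply: SM; split=> // Sz; [apply: nx|apply: ny]; exists S.
    + split; first exact: PU.
      move=> [S CS Sxy]; have [[[_ _ SU] _] _] := Cprime _ CS.
      suff [] : (P `\` S) (x `|` y)%O by [].
      by apply: SU; split=> // Sx; apply: nx; exists S.
  - by move=> PT; apply: PnT; apply/seteqP; split=> // x; rewrite -PT => -[].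
  - move=> x y [Pxy nxy]; apply: contrapT => /not_orP[nx ny].
    have noS S : prime_rfilter (P `\` S) -> ~ S (x `|` y)%O ->
        ~ (P `\` S) x -> ~ (P `\` S) y -> False.
      by move=> primeS nS nSx nSy; have [] := prime_rfilterU primeS (conj Pxy nS).
    have nC S : C S -> ~ S (x `|` y)%O by move=> CS Sxy; apply: nxy; exists S.
    have wit z : ~ (P `\` \bigcup_(X in C) X) z -> ~ P z \/ exists2 S, C S & S z.
      by move=> nz; have [Pz|] := pselect (P z); [right; apply: contrapT => ?; apply: nz|left].
    (* For an empty chain only the first case arises; there the primality of [P] itself decides. *)
    have [nPx|[S CS Sx]] := wit _ nx; have [nPy|[T CT Ty]] := wit _ ny.
    + by have [] := prime_rfilterU primeP Pxy.
    + by apply: (noS T (Cprime _ CT) (nC _ CT)) => -[].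
    + by apply: (noS S (Cprime _ CS) (nC _ CS)) => -[].
    + have [ST|TS] := Ctot _ _ CS CT.
      * by apply: (noS T (Cprime _ CT) (nC _ CT)) => -[_]; apply => //; exact: ST.
      * by apply: (noS S (Cprime _ CS) (nC _ CS)) => -[_]; apply => //; exact: TS.
exists (P `\` M); last exact: subDsetl.
split=> // Q primeQ QM; apply/seteqP; split=> // x [Px nMx].
(* A prime [Q] strictly inside [P] minus [M] would make the complement of [Q] a larger removable
   set, since removing it from [P] leaves [Q]. *)
apply: contrapT => nQx; apply: (Mmax (~` Q)).
  split=> [z Mz Qz|QM']; first by have [] := QM _ Qz.
  exact/nMx/QM'.
by rewrite setDE setCK setIidr // => z /QM[].
Qed.

Lemma bigcap_minimal_prime_rfilter a :
  (forall P, minimal_prime_rfilter P -> P a) -> a = \top%O.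
Proof.
move=> all_a; apply: contrapT => /exists_prime_rfilter_notin[P primeP nPa].
have [Q minQ QP] := exists_minimal_prime_rfilter P primeP.
exact: nPa (QP _ (all_a _ minQ)).
Qed.

Lemma closure_setC_hull X : closure (~` hull X) = hull (perp X).
Proof.
apply/seteqP; split.
  rewrite closureE; apply: smallest_sub; first by apply/closed_hullP; exists (perp X).
  move=> P /existsNP[x /not_implyP[Xx nPx]] a aX.
  have [primeP _] := minSpecP P.
  have : minSpec_set P (x `|` a)%O.
    by rewrite aX //; case: primeP => -[FP _] _; exact: rfilter1.
  by move=> /(prime_rfilterU primeP)[].
move=> P XP; rewrite closureE => C [/closed_hullP[Y ->] XY] y Yy.
(* It suffices that [y] is in [perp X]. A minimal prime [Q] either contains [X], hence [x], or lies
   off [hull X], hence in [hull Y], and contains [y]. *)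
apply: XP => x Xx; apply: bigcap_minimal_prime_rfilter => Q minQ.
have [[[[_ _ QU] _] _] _] := minQ.
have [XQ|nXQ] := pselect (X `<=` Q); first exact/QU/XQ.
by rewrite joinC; apply: QU; exact: (XY (MinSpec minQ)).
Qed.

End MinimalPrimes.

Theorem proposition4p8 (d : Order.disp_t) (A : residuatedLatticeType d) :
  extremally_disconnected (minSpec A) <->
  (forall X : set A, open (hull (perp X))).
Proof.
split=> [ed X|op U oU].
  rewrite -closure_setC_hull; apply: ed; rewrite openC.
  by apply/closed_hullP; exists X.
have [X UX] : exists X : set A, ~` U = hull X.
  by apply/closed_hullP; rewrite closedC.
by rewrite -[U]setCK UX closure_setC_hull.
Qed.
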